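(* Let $V$ be a truth value set, $\triangleright$ a total order on $V$, and $\widehat{R}:V\to V$ a modification operator corresponding to a choice operator $\breve{R}$ with respect to $\triangleright$. Then $\widehat{R}$ is a bijection from $V$ to $V$.
   Context: A truth value set is a set $V\subseteq[0,1]$ with $\{0,1\}\subseteq V$ and $1-v\in V$ for every $v\in V$. An $n$-adic truth function operator is a map $V^n\to V$. Formulas are built from propositional variables using truth function operators; a valuation $v$ assigns to each formula a value in $V$ homomorphically: $v(R(\phi_1,\dots,\phi_n))=R(v(\phi_1),\dots,v(\phi_n))$. For a total order $\triangleright$ on $V$, an element $x$ and a nonempty $Y\subseteq V$, write $x\triangleright Y$ if $x\triangleright y$ for all $y\in Y$, and $Y\triangleright x$ if $y\triangleright x$ for all $y\in Y$. A choice operator with respect to $\triangleright$ is an operator $\breve{R}:V^n\to V$ with $n\ge 2$ such that $v(\breve{R}(\phi_1,\dots,\phi_n))=v(\phi_i)$ where $v(\phi_i)\triangleright\{v(\phi_j)\mid j\ne i\}$ (it returns the $\triangleright$-greatest argument). A modification operator corresponding to $\breve{R}$ is an operator $\widehat{R}:V\to V$ such that whenever $v(\breve{R}(\phi_1,\dots,\phi_n))=v(\phi_i)$ and $v(\phi_i)\triangleright\{v(\phi_j)\mid j\neq i\}$, one has $\{v(\widehat{R}(\phi_j))\mid j\ne i\}\triangleright v(\widehat{R}(\phi_i))$ and $v(\widehat{R}(\widehat{R}(\phi_i)))=v(\phi_i)$. *)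

(* Defs.v *)
From HB Require Import structures.
From mathcomp Require Import all_boot all_order all_algebra.
From mathcomp Require Import boolp classical_sets set_interval reals.

Set Implicit Arguments.
Unset Strict Implicit.
Unset Printing Implicit Defensive.

Import Order.TTheory GRing.Theory Num.Theory.
Local Open Scope classical_set_scope.
Local Open Scope ring_scope.

Definition truth_value_set (R : realType) (V : set R) : Prop :=
  [/\ V `<=` `[0, 1],
      [set 0; 1] `<=` V
    & forall v, V v -> V (1 - v)].

(* Non-strict; [r x y] reads "x \triangleright y", i.e. x is the greater one. *)
Definition total_order (T : Type) (r : rel T) : Prop :=
  [/\ reflexive r, antisymmetric r, transitive r & total r].

Definition operator (T : Type) (n : nat) : Type := {ffun 'I_n -> T} -> T.

(* Every truth function operator is used as a connective denoting itself. *)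
Inductive formula (T : Type) : Type :=
| Var of nat
| App (n : nat) of operator T n & {ffun 'I_n -> formula T}.

Definition valuation (T : Type) (v : formula T -> T) : Prop :=
  forall n (op : operator T n) (phi : {ffun 'I_n -> formula T}),
    v (App op phi) = op [ffun i => v (phi i)].

Definition unary (T : Type) (f : T -> T) : operator T 1 := fun x => f (x ord0).

Definition App1 (T : Type) (f : T -> T) (phi : formula T) : formula T :=
  App (unary f) [ffun => phi].

Definition above (T : Type) (r : rel T) (x : T) (Y : set T) : Prop :=
  forall y, Y y -> r x y.

Definition below (T : Type) (r : rel T) (Y : set T) (x : T) : Prop :=
  forall y, Y y -> r y x.

Definition choice_operator (T : Type) (r : rel T) (n : nat)
    (C : operator T n) : Prop :=
  (2 <= n)%N /\
  forall (v : formula T -> T), valuation v ->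
  forall (phi : {ffun 'I_n -> formula T}) (i : 'I_n),
    above r (v (phi i)) [set v (phi j) | j in [set j | j != i]] ->
    v (App C phi) = v (phi i).

Definition modification_operator (T : Type) (r : rel T) (n : nat)
    (C : operator T n) (M : T -> T) : Prop :=
  forall (v : formula T -> T), valuation v ->
  forall (phi : {ffun 'I_n -> formula T}) (i : 'I_n),
    v (App C phi) = v (phi i) ->
    above r (v (phi i)) [set v (phi j) | j in [set j | j != i]] ->
    below r [set v (App1 M (phi j)) | j in [set j | j != i]]
            (v (App1 M (phi i))) /\
    v (App1 M (App1 M (phi i))) = v (phi i).

(* Main.v *)
(* Apply the modification axiom to n copies of one variable of value x: by
   reflexivity any argument is greatest, so M (M x) = x, and an involution is
   bijective. *)
Require Import Defs.
From HB Require Import structures.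
From mathcomp Require Import all_boot all_order all_algebra.
From mathcomp Require Import boolp classical_sets set_interval reals.

(** Maximality is non-strict, so among arguments sharing one value [x] each counts as greatest. The
    involution clause of the axiom then yields [M (M x) = x] for every [x], so [M] is its own
    inverse. Both axioms quantify over valuations; [eval] provides one realising any prescribed
    [x]. *)

Fixpoint eval (T : Type) (e : nat -> T) (phi : formula T) : T :=
  match phi with
  | Var k => e k
  | App n op psi => op [ffun i => eval T e (psi i)]
  end.

Lemma eval_valuation (T : Type) (e : nat -> T) : valuation (eval T e).
Proof. by []. Qed.

Lemma valuation_App1 (T : Type) (v : formula T -> T) (f : T -> T)
    (phi : formula T) : valuation v -> v (App1 f phi) = f (v phi).
Proof. by move=> hv; rewrite /App1 hv /unary !ffunE. Qed.

Lemma modification_operator_involutive (T : Type) (r : rel T) (n : nat)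
    (C : operator T n) (M : T -> T) :
  reflexive r -> choice_operator r C -> modification_operator r C M ->
  involutive M.
Proof.
move=> rr [n_ge2 hC] hM x.
have hv := eval_valuation T (fun=> x).
(* Index 0, which exists because the arity is at least 2. *)
pose i : 'I_n := Ordinal (ltnW n_ge2).
pose phi : {ffun 'I_n -> formula T} := [ffun => Var T 0].
have vphi j : eval T (fun=> x) (phi j) = x by rewrite ffunE.
have top : above r (eval T (fun=> x) (phi i))
    [set eval T (fun=> x) (phi j) | j in [set j | j != i]]%classic.
  by move=> _ [j _ <-]; rewrite !vphi.
(* The choice axiom supplies the premise that [C] returns argument [i]; only the involution clause
   is kept. *)
have [_] := hM _ hv phi i (hC _ hv phi i top) top.
by rewrite !valuation_App1 // vphi.
Qed.

Theorem theorem2 (R : realType) (V : set R) (hV : truth_value_set V)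
    (r : rel V) (hr : total_order r)
    (n : nat) (C : operator V n) (hC : choice_operator r C)
    (M : V -> V) (hM : modification_operator r C M) :
  bijective M.
Proof.
have [rr _ _ _] := hr.
exact: inv_bij (modification_operator_involutive _ _ _ _ _ rr hC hM).
Qed.
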